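(* Let $\Phi:U\times G\to U\times G$, $\Phi(z,\boldsymbol{t})=(\phi_{\boldsymbol t}(z),\tau(\boldsymbol t))$, be a fiberwise Hamiltonian deformation with primitive function $p:U\times G\to\mathbb{R}$, generator $\mathcal{F}:U\times G\to\mathbb{R}^{2n\times m}$ and moment map $\mathcal{M}:U\times G\to\mathbb{R}^m$. Then for all $\boldsymbol t\in G$ (and all $z\in U$) the moment map satisfies $$\mathcal{F}_{\boldsymbol t}(z)=\Omega(z)^{-1}\big(\mathrm{D}_z\mathcal{M}_{\boldsymbol t}(z)\big)^\top .$$
   Context: All maps are assumed sufficiently smooth. $U\subset\mathbb{R}^{2n}$ and $G\subset\mathbb{R}^m$ are open. $\mathrm{D}$, $\mathrm{D}_z$, $\mathrm{D}_{\boldsymbol t}$ denote (partial) Jacobian matrices, so the derivative of a scalar function is a row vector. $a:U\to\mathbb{R}^{2n}$ is a smooth map such that $\Omega(z):=\mathrm{D}a(z)^\top-\mathrm{D}a(z)$ is invertible for every $z\in U$ ($\Omega$ represents an exact symplectic form on $U$). A fiberwise symplectic deformation in $U$ with base $G$ is a smooth diffeomorphism $\Phi:U\times G\to U\times G$, $\Phi(z,\boldsymbol t)=(\phi_{\boldsymbol t}(z),\tau(\boldsymbol t))$, such that for all $\boldsymbol t\in G$ the map $\phi_{\boldsymbol t}:U\to U$ is symplectic, i.e. $\mathrm{D}\phi_{\boldsymbol t}(z)^\top\Omega(\phi_{\boldsymbol t}(z))\mathrm{D}\phi_{\boldsymbol t}(z)=\Omega(z)$; $\tau:G\to G$ is the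 base map. The maps $\tau$ and $\phi_{\boldsymbol t}$ are understood to be diffeomorphisms of $G$ and $U$ respectively (their inverses are used below). We write $\phi(z,\boldsymbol t)=\phi_{\boldsymbol t}(z)$. The deformation is called Hamiltonian if each $\phi_{\boldsymbol t}$ is exact symplectic. Its primitive function is a smooth function $p:U\times G\to\mathbb{R}$, $p_{\boldsymbol t}(z)=p(z,\boldsymbol t)$, such that for all $\boldsymbol t\in G$ $$\mathrm{D}_zp_{\boldsymbol t}(z)=a(\phi_{\boldsymbol t}(z))^\top\mathrm{D}_z\phi_{\boldsymbol t}(z)-a(z)^\top .$$ The generator of $\Phi$ is $\mathcal{F}_{\boldsymbol t}(z)=\mathcal{F}(z,\boldsymbol t):=\mathrm{D}_{\boldsymbol t}\phi\big(\phi^{-1}_{\tau^{-1}(\boldsymbol t)}(z),\tau^{-1}(\boldsymbol t)\big)\in\mathbb{R}^{2n\times m}$, i.e. the Jacobian of $\phi$ with respect to its second argument evaluated at the indicated point. The moment map of $\Phi$ is $\mathcal{M}_{\boldsymbol t}(z)=\mathcal{M}(z,\boldsymbol t)\in\mathbb{R}^m$ (column vector), defined by $$\mathcal{M}_{\boldsymbol t}(z)^\top:=a(z)^\top\mathcal{F}_{\boldsymbol t}(z)-\mathrm{D}_{\boldsymbol t}p\big(\phi^{-1}_{\tau^{-1}(\boldsymbol t)}(z),\tau^{-1}(\boldsymbol t)\big),$$ where again $\mathrm{D}_{\boldsymbol t}p$ is the Jacobian of $p$ with respect to its second argument evaluated at the indicated point. *)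

(* Defs.v *)
From mathcomp Require Import all_boot all_order all_algebra.
From mathcomp Require Import boolp classical_sets functions reals.
From mathcomp Require Import topology normedtype derive.
Import numFieldNormedType.Exports.

Set Implicit Arguments.
Unset Strict Implicit.
Unset Printing Implicit Defensive.

Local Open Scope classical_set_scope.
Local Open Scope ring_scope.

(* f is of class C^k on A, for finite-dimensional V and open A: the
   derivatives below are those of a map on the whole of V, and for A open they
   only depend on f restricted to A. *)
Fixpoint class_C (R : realType) (V W : normedModType R) (k : nat)
    (A : set V) (f : V -> W) : Prop :=
  if k is k'.+1 then
    (forall x, A x -> differentiable f x) /\
    (forall v, class_C k' A (fun x => 'D_v f x))
  else forall x, A x -> {for x, continuous f}.

(* C^k diffeomorphism of A onto itself; 'pinv_(fun=> 0) A f is the inverse of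
   f : A -> A, extended by 0 outside of f @` A. *)
Definition diffeomorphism (R : realType) (V : normedModType R) (k : nat)
    (A : set V) (f : V -> V) : Prop :=
  [/\ set_bij A A f, class_C k A f & class_C k A ('pinv_(fun=> 0) A f)].

(* Points of R^k are stored as row vectors, so that the column vector v of the
   mathematics is v^T here and the row vector v^T is v. The library's 'J acts
   on row vectors from the right; its transpose is the usual Jacobian matrix,
   with one row per component of f and one column per variable. *)
Definition Jac (R : realType) (k l : nat) (f : 'rV[R]_k -> 'rV[R]_l)
    (x : 'rV[R]_k) : 'M[R]_(l, k) := ('J f x)^T.

Definition Jac_scalar (R : realType) (k : nat) (f : 'rV[R]_k -> R)
    (x : 'rV[R]_k) : 'rV[R]_k := Jac (fun y => (f y)%:M : 'rV[R]_1) x.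

Section Deformations.
Context {R : realType} {n m : nat}.
Local Notation Z := 'rV[R]_(2 * n).
Local Notation T := 'rV[R]_m.
Implicit Types (r : nat) (U : set Z) (G : set T) (a f : Z -> Z).
Implicit Types (phi : Z -> T -> Z) (tau : T -> T) (p : Z -> T -> R).

Definition Omega a (z : Z) : 'M[R]_(2 * n) := (Jac a z)^T - Jac a z.

Definition symplectic U a f : Prop := forall z, U z ->
  (Jac f z)^T *m Omega a (f z) *m Jac f z = Omega a z.

Definition primitive U a f (S : Z -> R) : Prop := forall z, U z ->
  Jac_scalar S z = a (f z) *m Jac f z - a z.

Definition exact_symplectic r U a f : Prop :=
  symplectic U a f /\ exists S, class_C r U S /\ primitive U a f S.

Definition fiberwise_symplectic_deformation r U G a phi tau : Prop :=
  [/\ diffeomorphism r (U `*` G)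
        (fun zt : Z * T => (phi zt.1 zt.2, tau zt.2)),
      diffeomorphism r G tau,
      forall t, G t -> diffeomorphism r U (phi ^~ t) &
      forall t, G t -> symplectic U a (phi ^~ t)].

Definition fiberwise_Hamiltonian_deformation r U G a phi tau : Prop :=
  fiberwise_symplectic_deformation r U G a phi tau /\
  forall t, G t -> exact_symplectic r U a (phi ^~ t).

Definition primitive_function r U G a phi p : Prop :=
  class_C r (U `*` G) (fun zt : Z * T => p zt.1 zt.2) /\
  forall t, G t -> primitive U a (phi ^~ t) (p ^~ t).

Definition base_preimage G tau (t : T) : T := 'pinv_(fun=> 0) G tau t.

Definition fiber_preimage U G phi tau (z : Z) (t : T) : Z :=
  'pinv_(fun=> 0) U (phi ^~ (base_preimage G tau t)) z.

Definition generator U G phi tau (z : Z) (t : T) : 'M[R]_(2 * n, m) :=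
  Jac (phi (fiber_preimage U G phi tau z t)) (base_preimage G tau t).

Definition moment_map U G a phi tau p (z : Z) (t : T) : 'rV[R]_m :=
  a z *m generator U G phi tau z t -
  Jac_scalar (p (fiber_preimage U G phi tau z t)) (base_preimage G tau t).

End Deformations.

(* Main.v *)
Require Import Defs.
From mathcomp Require Import all_boot all_order all_algebra.
From mathcomp Require Import boolp classical_sets functions reals.
From mathcomp Require Import topology normedtype derive landau.
From mathcomp Require Import ring lra.
Import Order.TTheory GRing.Theory Num.Theory.
Import numFieldNormedType.Exports.

Set Implicit Arguments.
Unset Strict Implicit.
Unset Printing Implicit Defensive.

Local Open Scope classical_set_scope.
Local Open Scope ring_scope.

(** Write [F (z, t) = phi z t] and consider on [U `*` G] the 1-form
    [beta = F^* alpha - dp], where [alpha = a . dz]; in the code it is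
    [pullback_form a F p], which takes the tangent vector first and the base
    point second.

    Since second derivatives commute ([derive_comm]), [d (dp) = 0], and the
    exterior derivative of [beta] is the pullback under [F] of the 2-form
    [d alpha], whose matrix is [Omega]: this is [derive_pullback_form]
    together with [dot_Omega].

    Let [w] in [U], [s] in [G] and [F (w, s) = z]. Two facts about the
    components of [beta] turn this identity into the theorem.
    - In the fiber directions [(v, 0)] the primitive equation says that
      [beta] equals [a w . v], which does not depend on the base variable, so
      its derivative along a base direction [(0, u)] vanishes.
    - In the base directions [(0, u)], [beta] is the moment map [M] at the
      parameter [t = tau s], read in the source of the deformation:
      [beta (0, u) (y, s) = M (phi y s) . u].

    What remains of [d beta ((v, 0), (0, u))] is the derivative of [M . u] at
    [z] along [x = D_z phi v], and it equals [x^T Omega(z) F_t(z) u]. A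
    symplectic map has invertible Jacobian, so [x] runs over all vectors, and
    [Omega F_t = (D_z M)^T] follows.

    Commutation of second derivatives is proved in the form due to Young,
    where only the first derivatives at the point have to be differentiable:
    the mean value theorem shows that the symmetric second difference of [f]
    divided by [h^2] converges to [D_v (D_u f)]. *)

(** * Symmetry of second derivatives *)

(** Both functions have the same first order expansion at [x], and
    [diff_unique] identifies the linear part. Derivatives of a map known to be
    differentiable on an open set only satisfy the usual rules on that set, so
    the second order statements below need this locality. *)
Lemma near_eq_differentiable (R : numFieldType) (V W : normedModType R)
    (f g : V -> W) (x : V) :
  (\forall y \near x, f y = g y) -> differentiable f x -> differentiable g x.
Proof.
move=> fg df.
have gE : g \o shift x = cst (g x) + 'd f x +o_ 0 id.
  have /eqaddoP fE := diff_locally df.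
  apply/eqaddoP => e e0; have := fE e e0.
  apply: filter_app; near=> h.
  have fh : f (h + x) = g (h + x).
    near: h; have := fg; rewrite (near_shift 0) /= => fg0.
    by apply: filterS fg0 => h; rewrite /= subr0.
  rewrite -[X in _ -> `|X| <= _]/(g (h + x) - (g x + 'd f x h)).
  by rewrite -fh -(nbhs_singleton fg).
have dc := diff_continuous df.
apply/diff_locallyP; rewrite (diff_unique dc gE); split=> //.
Unshelve. all: by end_near. Qed.

Lemma is_derive_line (R : numFieldType) (V W : normedModType R)
    (f : V -> W) (u y : V) (s : R) :
  derivable f (s *: u + y) u ->
  is_derive s 1 (fun s => f (s *: u + y)) ('D_u f (s *: u + y)).
Proof.
have E : (fun h : R => h^-1 *: (((fun s => f (s *: u + y)) \o shift s) (h *: 1)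
      - f (s *: u + y))) =
    (fun h => h^-1 *: ((f \o shift (s *: u + y)) (h *: u) - f (s *: u + y))).
  by apply/funext => h /=; rewrite [h *: 1]mulr1 scalerDl addrA.
by move=> df; split; rewrite /derivable /derive E.
Qed.

(** By the mean value theorem along [u], the second difference is [h] times
    the increment over [h *: v] of ['D_u f] at some [c *: u + x] with
    [0 < c < h]. Expanding ['D_u f] at [x] to first order at both ends of this
    increment leaves [h * 'D_v ('D_u f) x] and an error [o(h)]. *)
Lemma second_difference_cvg (R : realType) (V : normedModType R) (f : V -> R)
    (x u v : V) :
  (\forall y \near x, differentiable f y) -> differentiable ('D_u f) x ->
  (h ^- 2 * (f (h *: u + (h *: v + x)) - f (h *: u + x) - f (h *: v + x) + f x))
    @[h --> 0^'+] --> 'D_v ('D_u f) x.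
Proof.
move=> df du.
rewrite (deriveE _ du); set L := 'd ('D_u f) x.
(* The points reached lie within [h * (|u| + |v|)] of [x], and the first order
   error is counted at two of them; the summand 1 makes [C] positive. *)
pose C := 1 + 2 * (`|u| + `|v|).
have C0 : 0 < C by rewrite /C ltr_pwDl// mulr_ge0// addr_ge0.
apply/cvgrPdist_le => e e0.
have /eqaddoP/(_ (e / C) (divr_gt0 e0 C0)) := diff_locally du.
rewrite -/L => /nbhs_normP[d1 /= d10 H1].
have /nbhs_normP[d2 /= d20 H2] := df.
pose d := Num.min d1 d2.
have d0 : 0 < d by rewrite lt_min d10 d20.
near=> h.
have h0 : 0 < h by near: h; exact: nbhs_right_gt.
have hd : h * C < d.
  rewrite -ltr_pdivlMr//; near: h; apply: nbhs_right_lt; exact: divr_gt0.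
have small (s t : R) : 0 <= s <= h -> 0 <= t <= h ->
    `|s *: u + t *: v| <= h * (`|u| + `|v|).
  move=> /andP[s0 sh] /andP[t0 th]; rewrite (le_trans (ler_normD _ _))//.
  by rewrite !normrZ !ger0_norm// mulrDr lerD// ler_wpM2r.
have hC : h * (`|u| + `|v|) < d.
  apply: le_lt_trans hd; rewrite ler_wpM2l 1?ltW// /C.
  by have := normr_ge0 u; have := normr_ge0 v; lra.
have dfl (s t : R) : 0 <= s <= h -> 0 <= t <= h ->
    differentiable f (s *: u + (t *: v + x)).
  move=> sh th; apply: H2; rewrite /= addrA opprD addrCA subrr addr0 normrN.
  apply: le_lt_trans (small _ _ sh th) _; apply: lt_le_trans hC _.
  by rewrite ge_min lexx orbT.
have duE (s t : R) : 0 <= s <= h -> 0 <= t <= h ->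
    `|'D_u f (s *: u + (t *: v + x)) - 'D_u f x - L (s *: u + t *: v)| <=
      e / C * (h * (`|u| + `|v|)).
  move=> sh th.
  have /H1 /= : ball_ Num.norm 0 d1 (s *: u + t *: v).
    rewrite /ball_ /= sub0r normrN.
    apply: le_lt_trans (small _ _ sh th) _; apply: lt_le_trans hC _.
    by rewrite ge_min lexx.
  rewrite -!fctE /= addrA opprD addrA => /le_trans; apply.
  by rewrite ler_wpM2l ?small// ltW// divr_gt0.
have hh : 0 <= h <= h by rewrite (ltW h0) /=.
have z0 : (0 : R) <= 0 <= h by rewrite lexx ltW.
pose g (s : R) := f (s *: u + (h *: v + x)) - f (s *: u + (0 *: v + x)).
pose dg s := 'D_u f (s *: u + (h *: v + x)) - 'D_u f (s *: u + (0 *: v + x)).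
have gd s : 0 <= s <= h -> is_derive s 1 g (dg s).
  by move=> sh; apply: is_deriveB; apply: is_derive_line;
    apply: diff_derivable; apply: dfl.
have [||c] := @MVT _ g dg _ _ h0.
- by move=> s; rewrite in_itv /= => /andP[s0 sh]; apply: gd; rewrite !ltW.
- apply: derivable_within_continuous => s; rewrite in_itv /= => sh.
  by have [] := gd s sh.
rewrite in_itv /= => /andP[c0 ch].
have cI : 0 <= c <= h by rewrite !ltW.
rewrite subr0 /g !scale0r !add0r => gE.
rewrite [X in h ^- 2 * X](_ : _ = dg c * h); last by rewrite -gE; ring.
rewrite (_ : _ - _ = - (h^-1 * (dg c - h * L v))); last by field; rewrite gt_eqF.
rewrite normrN normrM gtr0_norm ?invr_gt0// ler_pdivrMl//.
have -> : dg c - h * L v =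
   ('D_u f (c *: u + (h *: v + x)) - 'D_u f x - L (c *: u + h *: v)) -
   ('D_u f (c *: u + (0 *: v + x)) - 'D_u f x - L (c *: u + 0 *: v)).
  rewrite /dg scale0r addr0 linearD [L (h *: v)]linearZ /= -/L.
  by rewrite /GRing.scale /=; ring.
apply: le_trans (ler_normB _ _) _.
apply: le_trans (lerD (duE _ _ cI hh) (duE _ _ cI z0)) _.
rewrite [leLHS](_ : _ = h * (e / C * (2 * (`|u| + `|v|)))); last by ring.
rewrite ler_wpM2l ?(ltW h0)// mulrAC ler_pdivrMr// ler_wpM2l ?(ltW e0)// /C.
by rewrite lerDr.
Unshelve. all: by end_near. Qed.

(** The second difference is symmetric in [u] and [v]. *)
Lemma derive_comm (R : realType) (V : normedModType R) (f : V -> R)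
    (x u v : V) :
  (\forall y \near x, differentiable f y) ->
  differentiable ('D_u f) x -> differentiable ('D_v f) x ->
  'D_v ('D_u f) x = 'D_u ('D_v f) x.
Proof.
move=> df du dv.
have Dvu := second_difference_cvg (v := v) df du.
have := second_difference_cvg (v := u) df dv.
have -> : (fun h : R => h ^- 2 * (f (h *: v + (h *: u + x)) - f (h *: v + x) -
      f (h *: u + x) + f x)) =
    (fun h => h ^- 2 * (f (h *: u + (h *: v + x)) - f (h *: u + x) -
      f (h *: v + x) + f x)).
  by apply/funext => h; rewrite [in LHS]addrCA [in LHS](addrAC (f _)).
exact: cvg_unique Dvu.
Qed.

(** * Scalar products of row vectors *)

Definition dot (R : realType) (k : nat) (x y : 'rV[R]_k) : R :=
  \sum_i x 0 i * y 0 i.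

Section Dot.
Variable R : realType.

Lemma dotE k (x y : 'rV[R]_k) : x *m y^T = (dot x y)%:M.
Proof.
rewrite [LHS]mx11_scalar; congr (_%:M); rewrite mxE.
by apply: eq_bigr => i _; rewrite mxE.
Qed.

Lemma dotC k (x y : 'rV[R]_k) : dot x y = dot y x.
Proof. by apply: eq_bigr => i _; rewrite mulrC. Qed.

Lemma dot_delta k (x : 'rV[R]_k) i : dot x (delta_mx 0 i) = x 0 i.
Proof.
rewrite /dot (bigD1 i)//= big1 => [|j /negPf ji]; rewrite !mxE ?ji ?mulr0//.
by rewrite !eqxx mulr1 addr0.
Qed.

Lemma dotBl k (x1 x2 y : 'rV[R]_k) : dot (x1 - x2) y = dot x1 y - dot x2 y.
Proof.
by rewrite /dot -sumrB; apply: eq_bigr => i _; rewrite !mxE mulrBl.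
Qed.

Lemma dot_mulmxr k l (A : 'M[R]_(k, l)) (x : 'rV[R]_k) (y : 'rV[R]_l) :
  dot (x *m A) y = dot x (y *m A^T).
Proof.
have /(congr1 (fun M : 'M[R]_1 => M 0 0)) : (dot (x *m A) y)%:M =
    (dot x (y *m A^T))%:M :> 'M[R]_1.
  by rewrite -!dotE trmx_mul trmxK mulmxA.
by rewrite !mxE.
Qed.

Lemma mx_dot_eq k l (A B : 'M[R]_(k, l)) :
  (forall v u, dot (v *m A) u = dot (v *m B) u) -> A = B.
Proof.
move=> AB; apply/row_matrixP => i; apply/rowP => j.
by have := AB (delta_mx 0 i) (delta_mx 0 j); rewrite !dot_delta -!rowE.
Qed.

Section DotDerive.
Variables (k : nat) (V : normedModType R).

Lemma derive_coordinate (f : V -> 'rV[R]_k) (x v : V) i :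
  derivable f x v -> 'D_v f x 0 i = 'D_v (fun t => f t 0 i) x.
Proof. by move=> df; rewrite (derive_mx df) mxE. Qed.

Lemma is_derive_dot (f g : V -> 'rV[R]_k) (x v : V) :
  derivable f x v -> derivable g x v ->
  is_derive x v (fun t => dot (f t) (g t))
    (dot ('D_v f x) (g x) + dot (f x) ('D_v g x)).
Proof.
move=> df dg; have /derivable_mxP dfi := df; have /derivable_mxP dgi := dg.
have -> : (fun t => dot (f t) (g t)) =
    \sum_(i < k) ((fun t => f t 0 i) * (fun t => g t 0 i)).
  by apply/funext => t; rewrite fct_sumE.
have dfg i : is_derive x v ((fun t => f t 0 i) * (fun t => g t 0 i))
   ('D_v f x 0 i * g x 0 i + f x 0 i * 'D_v g x 0 i).
  rewrite (derive_coordinate _ df) (derive_coordinate _ dg).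
  have := is_deriveM (derivableP (dfi 0 i)) (derivableP (dgi 0 i)).
  move=> /is_derive_eq; apply.
  by rewrite addrC /GRing.scale /= (mulrC (g x 0 i)).
have := is_derive_sum dfg; move=> /is_derive_eq; apply.
by rewrite /dot -big_split.
Qed.

Lemma differentiable_coordinates (f : V -> 'rV[R]_k) (x : V) :
  (forall i, differentiable (fun t => f t 0 i) x) -> differentiable f x.
Proof.
move=> df.
have -> : f = \sum_(i < k) (fun t => f t 0 i *: (delta_mx 0 i : 'rV[R]_k)).
  by apply/funext => t; rewrite fct_sumE -row_sum_delta.
by apply: differentiable_sum => i; apply: differentiableZl.
Qed.

Lemma differentiable_dot (f g : V -> 'rV[R]_k) (x : V) :
  differentiable f x -> differentiable g x ->
  differentiable (fun t => dot (f t) (g t)) x.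
Proof.
move=> df dg.
have -> : (fun t => dot (f t) (g t)) =
    \sum_(i < k) ((fun t => f t 0 i) * (fun t => g t 0 i)).
  by apply/funext => t; rewrite fct_sumE.
apply: differentiable_sum => i; apply: differentiableM.
  exact: (differentiable_comp df (differentiable_coord _ _ _)).
exact: (differentiable_comp dg (differentiable_coord _ _ _)).
Qed.

Lemma derive_dotl (f : V -> 'rV[R]_k) (b : 'rV[R]_k) (x v : V) :
  derivable f x v -> 'D_v (fun y => dot (f y) b) x = dot ('D_v f x) b.
Proof.
move=> df; have /@derive_val -> := is_derive_dot df (derivable_cst b x v).
rewrite derive_cst [X in _ + X]big1 ?addr0// => i _.
by rewrite mxE mulr0.
Qed.

End DotDerive.
End Dot.

(** * Maps that are twice differentiable at a point *)

(** Second order regularity is asked of the directional derivatives, as in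
    [class_C]. *)
Definition twice_differentiable (R : realType) (V W : normedModType R)
    (f : V -> W) (x : V) : Prop :=
  (\forall y \near x, differentiable f y) /\
  forall v, differentiable ('D_v f) x.

Lemma derive_comm_rV (R : realType) (V : normedModType R) (k : nat)
    (f : V -> 'rV[R]_k) (x u v : V) :
  twice_differentiable f x -> 'D_v ('D_u f) x = 'D_u ('D_v f) x.
Proof.
move=> [df d2f].
have fiE i w : \forall y \near x, 'D_w f y 0 i = 'D_w (fun t => f t 0 i) y.
  by apply: filterS df => y /diff_derivable dfy; exact: derive_coordinate.
apply/rowP => i.
have cE w w' : 'D_w ('D_w' f) x 0 i = 'D_w (fun t => 'D_w' f t 0 i) x.
  by apply: derive_coordinate; exact: diff_derivable.
apply: etrans (cE v u) (etrans _ (esym (cE u v))).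
apply: etrans (near_eq_derive v (fiE i u)) _.
apply: etrans (esym (near_eq_derive u (fiE i v))).
apply: derive_comm.
- apply: filterS df => y dfy.
  exact: (differentiable_comp dfy (differentiable_coord _ _ _)).
- apply: near_eq_differentiable (fiE i u) _.
  exact: (differentiable_comp (d2f u) (differentiable_coord _ _ _)).
- apply: near_eq_differentiable (fiE i v) _.
  exact: (differentiable_comp (d2f v) (differentiable_coord _ _ _)).
Qed.

Lemma derive_comp (R : numFieldType) (V W X : normedModType R)
    (f : V -> W) (g : W -> X) (x v : V) :
  differentiable f x -> differentiable g (f x) ->
  'D_v (g \o f) x = 'D_('D_v f x) g (f x).
Proof.
move=> df dg; apply: etrans (deriveE v (differentiable_comp df dg)) _.
by rewrite (diff_comp df dg) (deriveE v df) (deriveE _ dg).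
Qed.

Lemma class_C_twice (R : realType) (V W : normedModType R) k
    (A : set V) (f : V -> W) x :
  open A -> A x -> (2 <= k)%N -> class_C k A f -> twice_differentiable f x.
Proof.
case: k => [|[|k]]// oA Ax _ [df d2f]; split.
  by apply: filterS (open_nbhs_nbhs (conj oA Ax)) => y; exact: df.
by move=> v; have [+ _] := d2f v; apply.
Qed.

Lemma class_C_differentiable (R : realType) (V W : normedModType R) k
    (A : set V) (f : V -> W) x :
  A x -> (0 < k)%N -> class_C k A f -> differentiable f x.
Proof. by case: k => // k Ax _ [df _]; exact: df. Qed.

(** The first projection is linear and commutes with derivatives. *)
Lemma twice_differentiable_fst (R : realType) (V W W' : normedModType R)
    (f : V -> W) (g : V -> W') x :
  twice_differentiable (fun y => (f y, g y)) x -> twice_differentiable f x.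
Proof.
move=> [dfg d2fg].
have cfst : continuous (fst : {linear (W * W')%type -> W}).
  by move=> ?; exact: cvg_fst.
have dfst (z : W * W') : differentiable fst z by exact: linear_differentiable.
split.
  by apply: filterS dfg => y dy; exact: (differentiable_comp dy (dfst _)).
move=> v.
have E : \forall y \near x, ('D_v (fun y => (f y, g y)) y).1 = 'D_v f y.
  apply: filterS dfg => y dy.
  by rewrite [RHS](derive_comp v dy (dfst _)) (deriveE _ (dfst _)) diff_lin.
apply: near_eq_differentiable E _.
exact: (differentiable_comp (d2fg v) (dfst _)).
Qed.

(** * The 1-form [F^* alpha - dp] and its exterior derivative *)

Section Pullback.
Variables (R : realType) (V : normedModType R) (k : nat).
Variables (a : 'rV[R]_k -> 'rV[R]_k) (f : V -> 'rV[R]_k) (p : V -> R).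

Definition pullback_form (u x : V) : R :=
  dot (a (f x)) ('D_u f x) - 'D_u p x.

Variable x : V.
Hypotheses (da : differentiable a (f x)) (df : twice_differentiable f x)
  (dp : twice_differentiable p x).

Lemma differentiable_pullback_form u : differentiable (pullback_form u) x.
Proof.
have [dfn d2f] := df; have [dpn d2p] := dp.
apply: differentiableB => //; apply: differentiable_dot => //.
exact: differentiable_comp (nbhs_singleton dfn) da.
Qed.

(** The value on [(v, u)] of the exterior derivative of [f^* alpha - dp],
    where [alpha = a . dz], is that of [f^* (d alpha)]: the terms with a second
    derivative of [f] or [p] are symmetric in [u] and [v] and cancel. *)
Lemma derive_pullback_form u v :
  'D_v (pullback_form u) x - 'D_u (pullback_form v) x =
  dot ('D_('D_v f x) a (f x)) ('D_u f x) -
  dot ('D_('D_u f x) a (f x)) ('D_v f x).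
Proof.
have [dfn d2f] := df; have [dpn d2p] := dp.
have dfx := nbhs_singleton dfn.
have daf := differentiable_comp dfx da.
have afE w : 'D_w (a \o f) x = 'D_('D_w f x) a (f x).
  exact: derive_comp.
have DE w w' : 'D_w (pullback_form w') x =
    dot ('D_('D_w f x) a (f x)) ('D_w' f x) +
    dot (a (f x)) ('D_w ('D_w' f) x) - 'D_w ('D_w' p) x.
  have daw : derivable (a \o f) x w by exact: diff_derivable.
  have dfw : derivable ('D_w' f) x w by exact: diff_derivable.
  have dpw : derivable ('D_w' p) x w by exact: diff_derivable.
  have [ddw ddE] := is_derive_dot daw dfw.
  apply: etrans (deriveB ddw dpw) _.
  by rewrite ddE afE.
have cancel_sym (A B C D : R) : A + C - D - (B + C - D) = A - B by ring.
rewrite (DE u v) (DE v u) (derive_comm_rV u v df).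
rewrite (derive_comm dpn (d2p u) (d2p v)); exact: cancel_sym.
Qed.
End Pullback.

(** * Derivatives along the factors of a product, and Jacobians *)

Section SlicesAndJacobians.
Variable R : realType.

Lemma derive_slice1 (Z T W : normedModType R) (f : Z * T -> W) z t v :
  'D_v (fun y => f (y, t)) z = 'D_(v, 0) f (z, t).
Proof.
have E h : h *: (v, 0) + (z, t) = (h *: v + z, t) :> Z * T.
  by apply: (etrans (y := (h *: v + z, h *: 0 + t))); rewrite // scaler0 add0r.
rewrite /derive (_ : (fun h => _) = fun h =>
  h^-1 *: ((f \o shift (z, t)) (h *: (v, 0)) - f (z, t)))//.
by apply/funext => h; rewrite /= E.
Qed.

Lemma derive_slice2 (Z T W : normedModType R) (f : Z * T -> W) z t v :
  'D_v (fun y => f (z, y)) t = 'D_(0, v) f (z, t).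
Proof.
have E h : h *: (0, v) + (z, t) = (z, h *: v + t) :> Z * T.
  by apply: (etrans (y := (h *: 0 + z, h *: v + t))); rewrite // scaler0 add0r.
rewrite /derive (_ : (fun h => _) = fun h =>
  h^-1 *: ((f \o shift (z, t)) (h *: (0, v)) - f (z, t)))//.
by apply/funext => h; rewrite /= E.
Qed.

Lemma differentiable_slice1 (Z T W : normedModType R) (f : Z * T -> W) z t :
  differentiable f (z, t) -> differentiable (fun y => f (y, t)) z.
Proof.
by move=> df; apply: (@differentiable_comp _ _ _ _ (fun y => (y, t)) f).
Qed.

Lemma differentiable_slice2 (Z T W : normedModType R) (f : Z * T -> W) z t :
  differentiable f (z, t) -> differentiable (fun y => f (z, y)) t.
Proof.
by move=> df; apply: (@differentiable_comp _ _ _ _ (fun y => (z, y)) f).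
Qed.

Lemma mul_trJac k l (f : 'rV[R]_k -> 'rV[R]_l) x u :
  differentiable f x -> u *m (Jac f x)^T = 'D_u f x.
Proof. by move=> df; rewrite trmxK deriveEjacobian. Qed.

Lemma dot_mul_Jac k l (f : 'rV[R]_k -> 'rV[R]_l) x b u :
  differentiable f x -> dot (b *m Jac f x) u = dot b ('D_u f x).
Proof. by move=> df; rewrite dot_mulmxr mul_trJac. Qed.

Lemma dot_Jac_scalar k (f : 'rV[R]_k -> R) x u :
  differentiable f x -> dot (Jac_scalar f x) u = 'D_u f x.
Proof.
move=> df; pose g y : 'rV[R]_1 := (f y)%:M.
have dg : differentiable g x.
  apply: differentiable_coordinates => i; rewrite /g.
  by under eq_fun do rewrite mxE ord1 eqxx mulr1n.
have -> : Jac_scalar f x = (1%:M : 'rV_1) *m Jac g x by rewrite mul1mx.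
rewrite (dot_mul_Jac _ _ dg) /dot big_ord1 mxE eqxx mul1r.
rewrite (derive_coordinate _ (diff_derivable dg)).
by congr ('D_u _ x); apply/funext => y; rewrite mxE eqxx mulr1n.
Qed.

(** [Omega] is the matrix of the exterior derivative of [a . dz]. *)
Lemma dot_Omega k (a : 'rV[R]_k -> 'rV[R]_k) z x y : differentiable a z ->
  dot (x *m ((Jac a z)^T - Jac a z)) y = dot ('D_x a z) y - dot ('D_y a z) x.
Proof.
by move=> da; rewrite mulmxBr dotBl mul_trJac// dot_mul_Jac// (dotC x).
Qed.

End SlicesAndJacobians.

(** * The moment map of a fiberwise Hamiltonian deformation *)

Lemma open_setX (S T : topologicalType) (A : set S) (B : set T) :
  open A -> open B -> open (A `*` B).
Proof.
move=> oA oB; rewrite openE => -[x y] [/= Ax By].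
by exists (A, B) => //; split; apply: open_nbhs_nbhs.
Qed.

Lemma set_bij_pinv (V : zmodType) (A : set V) (f : V -> V) :
  set_bij A A f ->
  [/\ forall y, A y -> A ('pinv_(fun=> 0) A f y),
      forall y, A y -> f ('pinv_(fun=> 0) A f y) = y &
      forall x, A x -> 'pinv_(fun=> 0) A f (f x) = x].
Proof.
move=> fbij; have [_ finj fsurj] := fbij; split.
- by have [] := bijpinv_bij (fun=> 0) fbij.
- by move=> y /mem_set Ay; apply: surjpK fsurj _ Ay.
- by move=> x /mem_set Ax; apply: pinvKV.
Qed.

Theorem lemmaE1 (R : realType) (n m r : nat)
    (U : set 'rV[R]_(2 * n)) (G : set 'rV[R]_m)
    (a : 'rV[R]_(2 * n) -> 'rV[R]_(2 * n))
    (phi : 'rV[R]_(2 * n) -> 'rV[R]_m -> 'rV[R]_(2 * n))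
    (tau : 'rV[R]_m -> 'rV[R]_m)
    (p : 'rV[R]_(2 * n) -> 'rV[R]_m -> R)
    (r_ge2 : (2 <= r)%N)
    (openU : open U) (openG : open G)
    (a_smooth : class_C r U a)
    (Omega_unit : forall z, U z -> Omega a z \in unitmx)
    (Phi_Hamiltonian : fiberwise_Hamiltonian_deformation r U G a phi tau)
    (p_primitive : primitive_function r U G a phi p) :
  forall t z, G t -> U z ->
    generator U G phi tau z t =
    invmx (Omega a z) *m (Jac (fun y => moment_map U G a phi tau p y t) z)^T.
Proof.
move=> t z Gt Uz.
have r_gt0 : (0 < r)%N := ltnW r_ge2.
have [[[_ CPhi _] [tau_bij _ _] phi_diffeo phi_sympl] _] := Phi_Hamiltonian.
have [Cp p_prim] := p_primitive.
pose s := base_preimage G tau t.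
have Gs : G s by have [tauG _ _] := set_bij_pinv tau_bij; exact: tauG.
have [phis_bij _ Cg] := phi_diffeo s Gs.
have [gU phigK gphiK] := set_bij_pinv phis_bij.
pose g := 'pinv_(fun=> 0) U (phi ^~ s).
pose w := g z; have Uw : U w by exact: gU.
have phiw : phi w s = z by exact: phigK.
pose F (zt : 'rV[R]_(2 * n) * 'rV[R]_m) := phi zt.1 zt.2.
pose P (zt : 'rV[R]_(2 * n) * 'rV[R]_m) := p zt.1 zt.2.
have oUG := open_setX openU openG.
have F2 y t' : U y -> G t' -> twice_differentiable F (y, t').
  move=> Uy Gt'; have UGyt : (U `*` G) (y, t') by [].
  exact: twice_differentiable_fst (class_C_twice oUG UGyt r_ge2 CPhi).
have P2 y t' : U y -> G t' -> twice_differentiable P (y, t').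
  move=> Uy Gt'; have UGyt : (U `*` G) (y, t') by [].
  exact: (class_C_twice oUG UGyt r_ge2 Cp).
have Fd y t' : U y -> G t' -> differentiable F (y, t').
  by move=> Uy Gt'; exact: nbhs_singleton (F2 y t' Uy Gt').1.
have Pd y t' : U y -> G t' -> differentiable P (y, t').
  by move=> Uy Gt'; exact: nbhs_singleton (P2 y t' Uy Gt').1.
have ad y : U y -> differentiable a y.
  by move=> Uy; exact: (class_C_differentiable Uy r_gt0 a_smooth).
have gd : differentiable g z by exact: (class_C_differentiable Uz r_gt0 Cg).
pose M y := moment_map U G a phi tau p y t.
pose beta := pullback_form a F P.
(* The moment map composed with [phi ^~ s] is the base component of [beta]. *)
have ME u y : U y -> dot (M y) u = beta (0, u) (g y, s).
  move=> Uy; have Ugy : U (g y) by exact: gU.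
  rewrite dotBl dot_mul_Jac; last exact: (differentiable_slice2 (Fd _ _ Ugy Gs)).
  rewrite dot_Jac_scalar; last exact: (differentiable_slice2 (Pd _ _ Ugy Gs)).
  rewrite /beta /pullback_form -!derive_slice2.
  by have -> : F (g y, s) = y by exact: phigK.
have nearU y : U y -> \forall y' \near y, U y'.
  by move=> Uy; exact: open_nbhs_nbhs.
(* Needed because ['J M z] is only meaningful when [M] is differentiable. *)
have Md : differentiable M z.
  apply: differentiable_coordinates => i.
  have : \forall y \near z, beta (0, delta_mx 0 i) (g y, s) = M y 0 i.
    by apply: filterS (nearU z Uz) => y Uy; rewrite -ME// dot_delta.
  move=> /near_eq_differentiable; apply.
  apply: (@differentiable_comp _ _ _ _ g
    (fun y => beta (0, delta_mx 0 i) (y, s))) => //.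
  apply: differentiable_slice1; apply: differentiable_pullback_form.
  - by rewrite [F _]phiw; exact: ad.
  - exact: F2.
  - exact: P2.
have phid : differentiable (phi ^~ s) w.
  exact: (differentiable_slice1 (Fd _ _ Uw Gs)).
(* A symplectic Jacobian is a factor of the invertible matrix [Omega a w]. *)
have phi_unit : (Jac (phi ^~ s) w)^T \in unitmx.
  have := Omega_unit w Uw.
  by rewrite -(phi_sympl s Gs w Uw) !unitmx_mul => /andP[/andP[]].
(* The primitive equation: the fiber components of [beta] are those of
   [a . dz] at the source point, whatever the parameter. *)
have beta_const v : \forall t' \near s, beta (v, 0) (w, t') = dot (a w) v.
  apply: filterS (open_nbhs_nbhs (conj openG Gs)) => t' Gt'.
  rewrite /beta /pullback_form -!derive_slice1.
  have Fdt := differentiable_slice1 (Fd _ _ Uw Gt').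
  have Pdt := differentiable_slice1 (Pd _ _ Uw Gt').
  rewrite -(dot_Jac_scalar _ Pdt) -(dot_mul_Jac _ _ Fdt) -dotBl.
  have -> : Jac_scalar (fun y => P (y, t')) w =
    a (F (w, t')) *m Jac (fun y => F (y, t')) w - a w by exact: p_prim.
  by rewrite subKr.
suff OmegaF : Omega a z *m generator U G phi tau z t = (Jac M z)^T.
  by rewrite -OmegaF mulKmx// Omega_unit.
(* Multiplying by the Jacobian of [phi ^~ s], it suffices to test the
   equation on the vectors [x = 'D_v (phi ^~ s) w] and [u]. *)
apply: (can_inj (mulKmx phi_unit)); apply: mx_dot_eq => v u.
rewrite [in LHS]mulmxA [in LHS]mulmxA [in RHS]mulmxA (mul_trJac _ phid).
set x := 'D_v _ w.
have wd : differentiable (phi w) s.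
  exact: (differentiable_slice2 (Fd _ _ Uw Gs)).
rewrite (mul_trJac _ Md) (dot_mul_Jac _ _ wd) (dot_Omega _ _ (ad _ Uz)).
pose h y := dot (M y) u.
have hd : differentiable h (phi w s).
  by rewrite phiw; apply: differentiable_dot => //; exact: differentiable_cst.
have hE : \forall y \near w, (h \o phi ^~ s) y = beta (0, u) (y, s).
  apply: filterS (nearU w Uw) => y Uy; have Upy : U (phi y s).
    by have [+ _ _] := phis_bij; apply.
  by rewrite /h /= ME// [g _]gphiK.
have xM : dot ('D_x M z) u = 'D_(v, 0) (beta (0, u)) (w, s).
  rewrite -derive_slice1 -(near_eq_derive v hE) (derive_comp v phid hd) phiw.
  by rewrite (derive_dotl _ (diff_derivable Md)).
have beta0 : 'D_(0, u) (beta (v, 0)) (w, s) = 0.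
  rewrite -derive_slice2; apply: etrans (near_eq_derive u (beta_const v)) _.
  exact: derive_cst.
have aF : differentiable a (F (w, s)) by rewrite [F _]phiw; exact: ad.
have := derive_pullback_form aF (F2 _ _ Uw Gs) (P2 _ _ Uw Gs) (0, u) (v, 0).
rewrite -/beta -xM beta0 subr0 => ->.
by rewrite [F _]phiw -derive_slice1 -derive_slice2.
Qed.
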